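(* The wreath product $\mathbb{Z}_2 \wr \mathbb{F}_2$ is Cayley $2$-tape linear-time computable.
   Context: $\mathbb{F}_2$ is the free group of rank $2$ and $\mathbb{Z}_2 \wr \mathbb{F}_2$ is the restricted wreath product (lamplighter group over $\mathbb{F}_2$). For $k>1$, a $k$-tape Turing machine has $k$ semi-infinite tapes, each with the unmodifiable symbol $\boxplus$ in its leftmost cell (occurring only there); $\boxdot$ is the blank symbol. A function $f : \Sigma^* \to \Sigma^*$ is computed on a $k$-tape Turing machine in linear time if there is such a machine and a constant $C>0$ such that for every input $x \in \Sigma^*$ of length $n$, started with first tape $\boxplus x \boxdot^\infty$, the other tapes $\boxplus \boxdot^\infty$, all heads on $\boxplus$, the machine halts in an accepting state in at most $Cn$ steps with the first tape having prefix $\boxplus f(x) \boxdot$. A finitely generated group $G$ with finite set of semigroup generators $S$ is Cayley $k$-tape linear-time computable if there exist a finite alphabet $\Sigma$, a language $L \subseteq \Sigma^*$, a bijection $\psi : L \to G$ and, for each $s \in S$, a function $f_s : \Sigma^* \to \Sigma^*$ computed on a $k$-tape Turing machine in linear time such that $\psi(f_s(w)) = \psi(w)s$ for all $w \in L$ (independent of the choice of $S$).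
   Formalization: The time bound is taken as C(n+1) steps rather than Cn: with Cn, the empty input would force halting in 0 steps, so only the identity function would be computable and the claim would fail; for n ≥ 1 the two bounds agree up to the constant. *)

(* Defs.v *)
From HB Require Import structures.
From mathcomp Require Import all_boot finmap.
Set Implicit Arguments. Unset Strict Implicit. Unset Printing Implicit Defensive.

(* The free group F_2 on generators a, b, as reduced words.            *)
(* A letter (x, e): x = false for a, true for b; e = true for inverse. *)
Definition letter := (bool * bool)%type.
Definition linv (x : letter) : letter := (x.1, ~~ x.2).
Definition reduced (w : seq letter) : bool :=
  sorted (fun x y : letter => y != linv x) w.

Definition F2 := {w : seq letter | reduced w}.

Definition cons_red (x : letter) (w : seq letter) : seq letter :=
  if w is y :: w' then (if y == linv x then w' else x :: w) else [:: x].

Lemma cons_red_reduced x w : reduced w -> reduced (cons_red x w).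
Proof.
case: w => [|y w] //= Hw.
case: ifP => [_|/negbT Hne]; first exact: path_sorted Hw.
by rewrite /reduced /= Hne.
Qed.

Lemma foldr_cons_red_reduced (u v : seq letter) :
  reduced v -> reduced (foldr cons_red v u).
Proof. by elim: u => //= x u IH Hv; apply: cons_red_reduced; apply: IH. Qed.

Definition F2one : F2 := exist _ [::] isT.
Definition F2mul (u v : F2) : F2 :=
  exist _ (foldr cons_red (sval v) (sval u))
        (foldr_cons_red_reduced (sval u) (svalP v)).

(* Restricted wreath product Z_2 wr F_2 = (+)_{F_2} Z_2 |x F_2.        *)
(* A finitely supported lamp configuration F_2 -> Z_2 is the finite    *)
(* set of its lit lamps; F_2 acts by left translation.                 *)
Local Open Scope fset_scope.
Definition WP := ({fset F2} * F2)%type.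

Definition translate (g : F2) (A : {fset F2}) : {fset F2} :=
  [fset F2mul g x | x in A].
Definition symdiff (A B : {fset F2}) : {fset F2} := (A `\` B) `|` (B `\` A).

Definition WPone : WP := (fset0, F2one).
Definition WPmul (p q : WP) : WP :=
  (symdiff p.1 (translate p.2 q.1), F2mul p.2 q.2).
Local Close Scope fset_scope.

Definition semigroup_generates (G : eqType) (mul : G -> G -> G) (one : G)
    (S : seq G) : Prop :=
  forall g : G, exists2 ss : seq G,
    (ss != [::]) && all (fun s => s \in S) ss & g = foldr mul one ss.

Inductive move := MoveL | MoveS | MoveR.

Record TM (Sigma : finType) (k : nat) := {
  tm_state : finType;
  tm_gamma : finType;
  tm_inp : Sigma -> tm_gamma;
  tm_lend : tm_gamma;
  tm_blank : tm_gamma;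
  tm_start : tm_state;
  tm_halt : pred tm_state;
  tm_accept : pred tm_state;
  tm_delta : tm_state -> {ffun 'I_k -> tm_gamma} ->
             tm_state * {ffun 'I_k -> tm_gamma} * {ffun 'I_k -> move}
}.
Arguments tm_state {Sigma k} M : rename.
Arguments tm_gamma {Sigma k} M : rename.
Arguments tm_inp {Sigma k} M _ : rename.
Arguments tm_lend {Sigma k} M : rename.
Arguments tm_blank {Sigma k} M : rename.
Arguments tm_start {Sigma k} M : rename.
Arguments tm_halt {Sigma k} M _ : rename.
Arguments tm_accept {Sigma k} M _ : rename.
Arguments tm_delta {Sigma k} M _ _ : rename.

Definition TM_wf (Sigma : finType) (k : nat) (M : TM Sigma k) : Prop :=
  [/\ injective (tm_inp M),
      (forall x, tm_inp M x <> tm_lend M /\ tm_inp M x <> tm_blank M),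
      (tm_lend M <> tm_blank M),
      (forall q, tm_accept M q -> tm_halt M q) &
      forall q r, ~~ tm_halt M q ->
        forall i : 'I_k,
          let '(_, w, m) := tm_delta M q r in
          if r i == tm_lend M then w i = tm_lend M /\ m i <> MoveL
          else w i <> tm_lend M ].

Record config (Sigma : finType) (k : nat) (M : TM Sigma k) := Config {
  cf_state : tm_state M;
  cf_tape : 'I_k -> nat -> tm_gamma M;
  cf_head : 'I_k -> nat
}.

Definition head_move (m : move) (n : nat) : nat :=
  match m with MoveL => n.-1 | MoveS => n | MoveR => n.+1 end.

Definition step (Sigma : finType) (k : nat) (M : TM Sigma k)
    (c : config M) : config M :=
  if tm_halt M (cf_state c) then c else
  let r := [ffun i => cf_tape c i (cf_head c i)] in
  let '(q', w, m) := tm_delta M (cf_state c) r in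
  Config q'
    (fun i n => if n == cf_head c i then w i else cf_tape c i n)
    (fun i => head_move (m i) (cf_head c i)).

Definition init_tape (Sigma : finType) (k : nat) (M : TM Sigma k)
    (x : seq Sigma) (n : nat) : tm_gamma M :=
  if n is n'.+1 then nth (tm_blank M) (map (tm_inp M) x) n' else tm_lend M.

Definition init_config (Sigma : finType) (k : nat) (M : TM Sigma k)
    (x : seq Sigma) : config M :=
  Config (tm_start M)
    (fun i n => if val i == 0 then init_tape M x n
                else if n is _.+1 then tm_blank M else tm_lend M)
    (fun _ => 0).

Definition tape_has_prefix (Sigma : finType) (k : nat) (M : TM Sigma k)
    (t : nat -> tm_gamma M) (y : seq Sigma) : Prop :=
  [/\ t 0 = tm_lend M,
      (forall j, j < size y -> t j.+1 = nth (tm_blank M) (map (tm_inp M) y) j)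
    & t (size y).+1 = tm_blank M].

Definition linear_time_computable (k : nat) (Sigma : finType)
    (f : seq Sigma -> seq Sigma) : Prop :=
  exists (M : TM Sigma k) (C : nat),
    TM_wf M /\ 0 < C /\
    forall x : seq Sigma, exists2 t : nat, t <= C * (size x).+1 &
      let c := iter t (@step Sigma k M) (init_config M x) in
      [/\ tm_halt M (cf_state c), tm_accept M (cf_state c) &
          (0 < k -> forall i0 : 'I_k, val i0 = 0 ->
             tape_has_prefix (cf_tape c i0) (f x))].

Definition cayley_lin_computable (k : nat) (G : eqType) (mul : G -> G -> G)
    (S : seq G) : Prop :=
  exists (Sigma : finType) (L : seq Sigma -> Prop) (psi : seq Sigma -> G),
    (forall u v, L u -> L v -> psi u = psi v -> u = v) /\
    (forall g, exists2 w, L w & psi w = g) /\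
    (forall s, s \in S -> exists f : seq Sigma -> seq Sigma,
        linear_time_computable k f /\
        forall w, L w -> L (f w) /\ psi (f w) = mul (psi w) s).

(* Main.v *)
(* The element (A, g) is encoded by the lexicographically sorted list of the
   reduced words of g^-1 A followed by the reduced word of g^-1.  Right
   multiplication by any s then amounts to a fixed composition of two kinds of
   steps: toggling the empty word, and multiplying all words on the left by a
   letter x.  The latter edits only the beginning of each word and merely
   permutes blocks of the sorted list, so its result is the concatenation of
   the outputs of four finite-state transducers, each reading the whole code.
   A machine that moves its input to the second tape and then runs the
   transducers over it one after the other, appending their outputs on the
   first tape, takes linear time.  Since it leaves the first tape clean, such
   machines can be composed. *)

From HB Require Import structures.
Require Import Defs.
From mathcomp Require Import all_boot finmap zify.
From Stdlib Require Import ClassicalEpsilon.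
Set Implicit Arguments. Unset Strict Implicit. Unset Printing Implicit Defensive.

(** * Two-tape machines *)

Section Machines.
Variable Sigma : finType.

(* [None] is the left-end marker, [Some None] the blank. *)
Definition cell := option (option Sigma).
Definition tape := ((nat -> cell) * nat)%type.
Definition action := (option Sigma * move)%type.
Definition read (t : tape) : cell := t.1 t.2.

(** Nothing overwrites the marker and no left move leaves it, so every transition table yields a
    well-formed machine. *)
Definition act_tape (a : action) (t : tape) (n : nat) : cell :=
  if n == t.2 then omap (fun=> a.1) (read t) else t.1 n.

Definition act_head (a : action) (t : tape) : nat :=
  if (read t, a.2) is (None, MoveL) then t.2 else head_move a.2 t.2.

Arguments act_tape : simpl never.
Arguments act_head : simpl never.

Definition act (a : action) (t : tape) : tape := (act_tape a t, act_head a t).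

Record machine := Machine {
  mstate : finType;
  mstart : mstate;
  mdelta : mstate -> cell -> cell -> option mstate * action * action
}.

(* The state [None] is the exit of the machine. *)
Definition mconfig (M : machine) := (option (mstate M) * (tape * tape))%type.

Definition mstep (M : machine) (c : mconfig M) : mconfig M :=
  if c.1 is Some q then
    let '(q', a1, a2) := mdelta q (read c.2.1) (read c.2.2) in
    (q', (act a1 c.2.1, act a2 c.2.2))
  else c.

Definition reach (M : machine) (c : mconfig M) (N : nat)
    (P : mconfig M -> Prop) : Prop :=
  exists2 n, n <= N & P (iter n (@mstep M) c).

Definition exits (M : machine) (T : tape * tape) (N : nat)
    (P : tape * tape -> Prop) : Prop :=
  reach (Some (mstart M), T) N (fun c => c.1 = None /\ P c.2).

Lemma reach0 (M : machine) (c : mconfig M) N (P : mconfig M -> Prop) :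
  P c -> reach c N P.
Proof. by exists 0. Qed.

Lemma reachS (M : machine) (c : mconfig M) N (P : mconfig M -> Prop) :
  reach (mstep c) N P -> reach c N.+1 P.
Proof. by case=> n le_nN Pn; exists n.+1; rewrite // iterSr. Qed.

Lemma reachW (M : machine) (c : mconfig M) N N' (P P' : mconfig M -> Prop) :
  N <= N' -> (forall c', P c' -> P' c') -> reach c N P -> reach c N' P'.
Proof. by move=> le PP' [n le' Pn]; exists n; [exact: leq_trans le | exact: PP']. Qed.

Lemma reach_trans (M : machine) (c : mconfig M) N N' (P P' : mconfig M -> Prop) :
  reach c N P -> (forall c', P c' -> reach c' N' P') -> reach c (N + N') P'.
Proof.
case=> n le Pn /(_ _ Pn) [n' le' Pn']; exists (n' + n); first by rewrite addnC leq_add.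
by rewrite iterD.
Qed.

Lemma exitsW (M : machine) T N N' (P P' : tape * tape -> Prop) :
  N <= N' -> (forall T', P T' -> P' T') -> exits M T N P -> exits M T N' P'.
Proof. by move=> le PP'; apply: reachW => // c [? /PP']. Qed.

(** The step by which the first machine exits already enters the second one, so running times add
    without overhead. *)
Definition seqm_delta (M1 M2 : machine) (q : mstate M1 + mstate M2) (c1 c2 : cell) :
    option (mstate M1 + mstate M2) * action * action :=
  match q with
  | inl q1 => let '(q', a1, a2) := mdelta q1 c1 c2 in
              (Some (if q' is Some q1' then inl q1' else inr (mstart M2)), a1, a2)
  | inr q2 => let '(q', a1, a2) := mdelta q2 c1 c2 in (omap inr q', a1, a2)
  end.

Definition seqm (M1 M2 : machine) : machine :=
  Machine (inl (mstart M1)) (@seqm_delta M1 M2).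

Lemma seqm_left (M1 M2 : machine) n q T T' :
  iter n (@mstep M1) (Some q, T) = (None, T') ->
  reach ((Some (inl q), T) : mconfig (seqm M1 M2)) n
    (fun c => c = (Some (inr (mstart M2)), T')).
Proof.
elim: n q T => [|n IH] q T; first by [].
rewrite iterSr {2}/mstep /=.
case E: (mdelta q _ _) => [[[q'|] a1] a2] /=.
  by move=> /IH H; apply: reachS; rewrite /mstep /= E.
(* The exit is absorbing: the remaining iterations of [M1] change nothing. *)
have fixN m U : iter m (@mstep M1) (None, U) = (None, U).
  by elim: m => //= m ->.
by rewrite fixN => -[<-]; apply: reachS; apply: reach0; rewrite /mstep /= E.
Qed.

Lemma seqm_right (M1 M2 : machine) n (c : mconfig M2) :
  iter n (@mstep (seqm M1 M2)) (omap inr c.1, c.2)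
  = (omap inr (iter n (@mstep M2) c).1, (iter n (@mstep M2) c).2).
Proof.
elim: n => //= n ->; case: (iter n _ c) => [[q|] T] //=.
by rewrite /mstep /=; case: (mdelta q _ _) => [[q' a1] a2].
Qed.

Lemma seqm_exits (M1 M2 : machine) T N1 N2 (P Q : tape * tape -> Prop) :
  exits M1 T N1 P -> (forall T', P T' -> exits M2 T' N2 Q) ->
  exits (seqm M1 M2) T (N1 + N2) Q.
Proof.
case=> n le; case E: (iter _ _ _) => [q T'] /= [q0 PT'] H; subst q.
apply: (@reach_trans (seqm M1 M2) _ _ _ (fun c => c = (Some (inr (mstart M2)), T'))).
  by apply: reachW (seqm_left M2 E).
move=> _ ->; case: (H _ PT') => m lem [Hq HQ]; exists m => //.
by have /= -> := seqm_right M1 m (Some (mstart M2), T'); rewrite Hq.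
Qed.

Definition keep (c : cell) (m : move) : action := (oapp id None c, m).

Lemma act_keep f j c m : f j = c -> act_tape (keep c m) (f, j) =1 f.
Proof.
move=> <- n; rewrite /act_tape /read /=; case: eqP => [->|//].
by case: (f j).
Qed.

Definition tape_of (x : seq Sigma) (n : nat) : cell :=
  if n is n'.+1 then Some (onth x n') else None.

Definition marked (f : nat -> cell) : Prop :=
  f 0 = None /\ forall n, f n.+1 <> None.

(** The bound includes the blank after [x], by which the scanning head recognises the end; cells
    further right may hold remains of earlier runs. *)
Definition reads (x : seq Sigma) (f : nat -> cell) : Prop :=
  marked f /\ forall n, n <= size x -> f n.+1 = Some (onth x n).

(* Beyond its left end the second tape may contain anything, so that the final
   tapes of one machine can be the initial tapes of another. *)
Definition clean (x : seq Sigma) (T : tape * tape) : Prop :=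
  [/\ T.1.1 =1 tape_of x, T.1.2 = 0, marked T.2.1 & T.2.2 = 0].

(* The output [y] written so far is followed by the first head, while the
   second head scans [x]. *)
Definition passing (y x : seq Sigma) (j : nat) (T : tape * tape) : Prop :=
  [/\ T.1.1 =1 tape_of y, T.1.2 = (size y).+1, reads x T.2.1 & T.2.2 = j].

Lemma marked_tape_of x : marked (tape_of x).
Proof. by []. Qed.

Lemma marked_eq f g : f =1 g -> marked g -> marked f.
Proof. by move=> e [g0 gS]; split=> [|n]; rewrite e. Qed.

Lemma reads_eq x f g : f =1 g -> reads x g -> reads x f.
Proof.
by move=> e [mg rg]; split=> [|n /rg]; [exact: marked_eq mg | rewrite e].
Qed.

Lemma head_act_noL a t : a.2 <> MoveL -> act_head a t = head_move a.2 t.2.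
Proof. by rewrite /act_head; case: (read t); case: a.2. Qed.

Lemma head_act_pos f j a : marked f -> (act_head a (f, j.+1)) = head_move a.2 j.+1.
Proof. by case=> _ /(_ j); rewrite /act_tape /act_head /read /=; case: (f j.+1). Qed.

Lemma act_at0 f a : marked f -> (act_tape a (f, 0)) =1 f.
Proof. by case=> f0 _ [|n] //=; rewrite /act_tape /act_head /read /= f0. Qed.

Lemma act_pos f j a n : marked f ->
  (act_tape a (f, j.+1)) n = if n == j.+1 then Some a.1 else f n.
Proof. by case=> _ /(_ j); rewrite /act_tape /act_head /read /=; case: (f j.+1). Qed.

Lemma marked_act f j a : marked f -> marked (act_tape a (f, j)).
Proof.
move=> mf; case: j => [|j]; first exact: marked_eq (act_at0 a mf) mf.
split=> [|n]; rewrite act_pos //; first by case: mf.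
by case: eqP => // _; case: mf.
Qed.

(** * Moving the input to the second tape *)

Definition copy_delta (q : option bool) (c1 c2 : cell) :
    option (option bool) * action * action :=
  match q with
  | None => (Some (Some false), (None, MoveR), (None, MoveR))
  | Some false =>
      if c1 is Some (Some s)
      then (Some (Some false), (None, MoveR), (Some s, MoveR))
      else (Some (Some true), (None, MoveL), (None, MoveL))
  | Some true =>
      if c1 is None then (None, (None, MoveR), (None, MoveS))
      else (Some (Some true), keep c1 MoveL, keep c2 MoveL)
  end.
(** State [None] steps off the markers, [Some false] moves right, erasing one tape while filling the
    other, and [Some true] rewinds both heads in lockstep. *)
Definition copy_machine : machine := Machine None copy_delta.

Definition copying (x : seq Sigma) (j : nat) (T : tape * tape) : Prop :=
  [/\ marked T.1.1,
      forall n, T.1.1 n.+1 = Some (if n < j then None else onth x n),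
      marked T.2.1,
      forall n, n < j -> T.2.1 n.+1 = Some (onth x n)
    & T.1.2 = j.+1 /\ T.2.2 = j.+1].

Definition copied (x : seq Sigma) (j : nat) (T : tape * tape) : Prop :=
  [/\ T.1.1 =1 tape_of [::], T.1.2 = j, reads x T.2.1 & T.2.2 = j].

Lemma copy_loop x d j T : size x = j + d -> copying x j T ->
  reach ((Some (Some false), T) : mconfig copy_machine) d.+1
    (fun c => c.1 = Some (Some true) /\ copied x (size x) c.2).
Proof.
elim: d j T => [|d IH] j [[f1 h1] [f2 h2]] sz [/= m1 e1 m2 e2 [-> ->]];
  apply: reachS.
  have xj : onth x j = None by rewrite onth_default // sz addn0.
  rewrite /mstep /= /read /= e1 ltnn xj /=; apply: reach0; split=> //=.
  rewrite addn0 in sz; split; rewrite /= ?head_act_pos ?sz //.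
  - move=> n; rewrite act_pos //; case: n => [|n] /=; first by case: m1.
    rewrite eqSS; case: eqP => [_|ne]; first by rewrite onth0n.
    by rewrite e1 onth0n; case: ltnP => // le; rewrite onth_default ?sz.
  (* The last step to the right writes a blank on the second tape, which is the end mark that
     [reads] asks for. *)
  - split=> [|n]; first exact: marked_act.
    rewrite act_pos // sz leq_eqVlt eqSS => /orP[/eqP->|lt].
      by rewrite eqxx xj.
    by rewrite ltn_eqF //; apply: e2.
have [s xj] : exists s, onth x j = Some s.
  case E: (onth x j) => [s|]; first by exists s.
  by have := onthTE x j; rewrite E sz addnS ltnS leq_addr.
rewrite /mstep /= /read /= e1 ltnn xj /=; apply: (IH j.+1); first by lia.
split; rewrite /= ?head_act_pos //.
- exact: marked_act.
- move=> n; rewrite act_pos // eqSS; case: eqP => [->|ne]; first by rewrite ltnSn.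
  by rewrite e1 ltnS; congr Some; case: ltngtP ne.
- exact: marked_act.
- move=> n lt; rewrite act_pos // eqSS; case: eqP => [->|ne]; first by rewrite xj.
  by apply: e2; lia.
Qed.

Lemma copy_rewind x j T : copied x j T ->
  reach ((Some (Some true), T) : mconfig copy_machine) j.+1
    (fun c => c.1 = None /\ passing [::] x 0 c.2).
Proof.
elim: j T => [|j IH] [[f1 h1] [f2 h2]] [/= e1 -> e2 ->]; apply: reachS.
  rewrite /mstep /= e1 /=; apply: reach0; split=> //.
  have m1 := marked_eq e1 (marked_tape_of _).
  split=> //=.
  - by move=> n; rewrite -e1 -(act_at0 (None, MoveR) m1).
  - by rewrite head_act_noL.
  - by apply: (reads_eq _ e2); apply: act_at0; case: e2.
  - by rewrite head_act_noL.
have m1 := marked_eq e1 (marked_tape_of _).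
rewrite /mstep /= e1 /= onth0n; apply: IH.
split; rewrite /= ?head_act_pos //; try by case: e2.
  move=> n; rewrite act_pos //; case: eqP => [->|_]; last exact: e1.
  by rewrite /= onth0n.
by apply: reads_eq e2; apply: act_keep.
Qed.

Lemma copy_exits x T : clean x T ->
  exits copy_machine T (2 * size x + 3) (passing [::] x 0).
Proof.
move: T => [[f1 h1] [f2 h2]] [/= e1 -> m2 ->].
have m1 := marked_eq e1 (marked_tape_of _).
(* One step off the markers, [size x + 1] steps to the right and as many back. *)
have -> : 2 * size x + 3 = ((size x).+1 + (size x).+1).+1 by lia.
apply: reachS; rewrite /mstep /=.
apply: reach_trans (copy_loop (j := 0) _ _) _; first by [].
- split=> /=.
  + exact: marked_act.
  + by move=> n; rewrite (act_at0 _ m1) e1.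
  + exact: marked_act.
  + by [].
  + by rewrite !head_act_noL.
by move=> [q T] [/= ->]; apply: copy_rewind.
Qed.

(** * Transducer passes over the second tape *)

Record transducer := Transducer {
  tstate : finType;
  tstart : tstate;
  tdelta : tstate -> Sigma -> tstate * option Sigma * option Sigma
}.

Definition opt_seq (o : option Sigma) : seq Sigma := if o is Some s then [:: s] else [::].

Fixpoint trun (T : transducer) (q : tstate T) (x : seq Sigma) : seq Sigma :=
  if x is s :: x' then
    let '(q', o1, o2) := tdelta q s in opt_seq o1 ++ opt_seq o2 ++ trun q' x'
  else [::].

Lemma size_trun (T : transducer) (q : tstate T) x : size (trun q x) <= 2 * size x.
Proof.
elim: x q => //= s x IH q; case: (tdelta q s) => [[q' o1] o2].
by rewrite !size_cat; have := IH q'; case: o1; case: o2 => /=; lia.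
Qed.

Definition emit (o : option Sigma) : action := (o, if o then MoveR else MoveS).

(** A machine step writes at most one symbol, so each input symbol takes two steps; the flag tells
    whether the first output has been handled. [Some None] rewinds the second head. *)
Definition pass_delta (T : transducer) (q : option (option (tstate T * bool)))
    (c1 c2 : cell) : option (option (option (tstate T * bool))) * action * action :=
  match q with
  | None => (Some (Some (Some (tstart T, false))), keep c1 MoveS, keep c2 MoveR)
  | Some (Some (q, b)) =>
      if c2 is Some (Some s) then
        let '(q', o1, o2) := tdelta q s in
        if b then (Some (Some (Some (q', false))), emit o2, keep c2 MoveR)
        else (Some (Some (Some (q, true))), emit o1, keep c2 MoveS)
      else (Some (Some None), keep c1 MoveS, keep c2 MoveL)
  | Some None =>
      if c2 is None then (None, keep c1 MoveS, keep c2 MoveS)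
      else (Some (Some None), keep c1 MoveS, keep c2 MoveL)
  end.
Definition pass_machine (T : transducer) : machine := Machine None (@pass_delta T).

(** The head is on the first blank after [y]; emitting nothing replaces this blank by a blank. *)
Lemma tape_emit y t o : t.1 =1 tape_of y -> t.2 = (size y).+1 ->
  (act_tape (emit o) t) =1 tape_of (y ++ opt_seq o) /\
  (act_head (emit o) t) = (size (y ++ opt_seq o)).+1.
Proof.
case: t => [f h] /= e ->; have m := marked_eq e (marked_tape_of _).
split; last first.
  by rewrite head_act_pos // size_cat; case: o => [s|] /=; lia.
move=> n; rewrite act_pos //; case: n => [|n] /=; first by rewrite e.
rewrite eqSS e /=; case: o => [s|] /=; rewrite ?cats0 ?onth_cat.
  case: ltngtP => // [gt|->]; last by rewrite subnn.
  by rewrite !onth_default ?subn_gt0 ?(ltnW gt).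
by case: eqP => // ->; rewrite onth_default.
Qed.

Lemma tape_stay y t : t.1 =1 tape_of y -> t.2 = (size y).+1 ->
  (act_tape (keep (read t) MoveS) t) =1 tape_of y /\
  (act_head (keep (read t) MoveS) t) = (size y).+1.
Proof.
by case: t => f h e eh; split=> [n|]; [rewrite act_keep | rewrite head_act_noL].
Qed.

Lemma pass_rewind (U : transducer) y x j T : passing y x j T ->
  reach ((Some (Some None), T) : mconfig (pass_machine U)) j.+1
    (fun c => c.1 = None /\ passing y x 0 c.2).
Proof.
elim: j T => [|j IH] [t1 [f2 h2]] [/= e1 eh1 r2 ->]; apply: reachS;
  have [s1 sh1] := tape_stay e1 eh1; have [m2 _] := r2.
  rewrite /mstep /= /read /= m2.1 /=; apply: reach0; split=> //; split=> //=.
    by apply: (reads_eq _ r2); apply: act_at0.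
  by rewrite head_act_noL.
rewrite /mstep /= {2}/read /=.
case E: (f2 j.+1) => [o|]; last by case: m2 => _ /(_ j).
apply: IH; split=> //=; last by rewrite head_act_pos.
by apply: (reads_eq _ r2); apply: act_keep.
Qed.

(** Two steps for each of the [d] remaining symbols and one to meet the blank. *)
Lemma pass_loop (U : transducer) d y x j (q : tstate U) T :
  size x = j + d -> passing y x j.+1 T ->
  reach ((Some (Some (Some (q, false))), T) : mconfig (pass_machine U)) (2 * d).+1
    (fun c => c.1 = Some (Some None)
              /\ passing (y ++ trun q (drop j x)) x (size x) c.2).
Proof.
elim: d j y q T => [|d IH] j y q [t1 [f2 h2]] sz [/= e1 eh1 r2 ->].
  have xj : f2 j.+1 = Some None.
    by case: r2 => _ -> //; rewrite ?onth_default // sz; lia.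
  have [s1 sh1] := tape_stay e1 eh1.
  apply: reachS; rewrite /mstep /= {2}/read /= xj; apply: reach0; split=> //.
  rewrite drop_oversize ?cats0; last by lia.
  have [m2 _] := r2.
  split=> //=; last by rewrite head_act_pos //= sz addn0.
  by apply: (reads_eq _ r2); apply: act_keep.
have ltj : j < size x by lia.
have [s xs] : exists s, drop j x = s :: drop j.+1 x.
  case: x ltj {r2 sz IH} => // s0 x ltj.
  by exists (nth s0 (s0 :: x) j); rewrite (drop_nth s0).
have xj : f2 j.+1 = Some (Some s).
  case: r2 => _ -> //; last by lia.
  by rewrite -[x](cat_take_drop j) xs onth_cat size_take ltj ltnn subnn.
have -> : (2 * d.+1).+1 = (2 * d).+3 by lia.
apply: reachS; rewrite /mstep /= {1 2}/read /= xj xs /=.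
case E: (tdelta q s) => [[q' o1] o2].
have [a1 ah1] := tape_emit o1 e1 eh1.
set T1 := act (keep _ _) _.
have rT1 : reads x T1.1.
  by apply: (reads_eq _ r2); apply: act_keep.
have hT1 : T1.2 = j.+1 by rewrite /= head_act_noL.
have xj1 : T1.1 j.+1 = Some (Some s).
  by rewrite /T1 /= act_keep.
clearbody T1; case: T1 rT1 hT1 xj1 => [f2' h2'] /= rT1 -> xj1.
apply: reachS; rewrite /mstep /= xj1 E /=.
have [a2 ah2] := tape_emit (t := act (emit o1) t1) o2 a1 ah1.
rewrite !catA; apply: IH; first by lia.
split=> //=; last by rewrite head_act_noL.
by apply: (reads_eq _ rT1); apply: act_keep.
Qed.

Lemma pass_exits (U : transducer) y x T : passing y x 0 T ->
  exits (pass_machine U) T (3 * size x + 3) (passing (y ++ trun (tstart U) x) x 0).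
Proof.
case: T => [t1 [f2 h2]] [/= e1 eh1 r2 ->].
have [s1 sh1] := tape_stay e1 eh1.
(* One step off the marker, the scan, and [size x + 1] steps back. *)
have -> : 3 * size x + 3 = ((2 * size x).+1 + (size x).+1).+1 by lia.
apply: reachS; rewrite /mstep /=.
apply: reach_trans.
  apply: (@pass_loop _ (size x) y x 0) => //; split=> //=.
    by apply: (reads_eq _ r2); apply: act_at0; case: r2.
  by rewrite head_act_noL.
by move=> [q T] [/= ->]; rewrite drop0; apply: pass_rewind.
Qed.

Definition reset_machine : machine :=
  @Machine unit tt (fun _ c1 c2 =>
    if c1 is None then (None, keep c1 MoveS, keep c2 MoveS)
    else (Some tt, keep c1 MoveL, keep c2 MoveS)).

Lemma reset_exits y x T : passing y x 0 T ->
  exits reset_machine T (size y).+2 (clean y).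
Proof.
rewrite /exits /=; case: T => [[f1 h1] [f2 h2]] [/= e1 -> [m2 _] ->].
move: (size y).+1 => j.
elim: j f1 f2 e1 m2 => [|j IH] f1 f2 e1 m2; apply: reachS;
  have m1 := marked_eq e1 (marked_tape_of _);
  have m2' := marked_act 0 (keep (read (f2, 0)) MoveS) m2.
  rewrite /mstep /= e1 /=; apply: reach0; split=> //.
  split=> //=; rewrite ?head_act_noL //.
  by move=> n; rewrite -e1; apply: act_at0.
rewrite /mstep /= e1 /= /act head_act_pos //= head_act_noL //=.
apply: IH => // n; rewrite act_pos //=.
by case: eqP => [->|].
Qed.

(** * Composable linear-time functions *)

Definition clean_linear (f : seq Sigma -> seq Sigma) : Prop :=
  exists (M : machine) (C : nat), forall x,
    size (f x) <= C * (size x).+1 /\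
    forall T, clean x T -> exits M T (C * (size x).+1) (clean (f x)).

(** The length bound in [clean_linear] makes the time of the second machine linear in the original
    input: [(size (f x)).+1] is at most [C.+1 * (size x).+1]. *)
Lemma clean_linear_comp f g :
  clean_linear f -> clean_linear g -> clean_linear (g \o f).
Proof.
move=> [M [C HM]] [M' [C' HM']]; exists (seqm M M'), (C + C' * C.+1) => x.
have [sf Hf] := HM x; have [sg Hg] := HM' (f x).
have le : C' * (size (f x)).+1 <= C' * C.+1 * (size x).+1.
  by rewrite -mulnA leq_mul2l; apply/orP; right; nia.
split=> [|T cT]; first by apply: leq_trans sg _; apply: leq_trans le _; nia.
rewrite mulnDl.
apply: (@exitsW _ _ _ _ _ _ _ _ (seqm_exits (Hf T cT) Hg)) => //.
by rewrite leq_add2l.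
Qed.

Definition passes (Us : seq transducer) (x : seq Sigma) : seq Sigma :=
  flatten [seq trun (tstart U) x | U <- Us].

Definition passes_machine (Us : seq transducer) : machine :=
  foldr (fun U => seqm (pass_machine U)) reset_machine Us.

Lemma size_passes Us x : size (passes Us x) <= size Us * (2 * size x).
Proof.
elim: Us => //= U Us IH; rewrite /passes /= size_cat mulSn.
by apply: leq_add IH; apply: size_trun.
Qed.

Lemma passes_exits Us y x T : passing y x 0 T ->
  exits (passes_machine Us) T
    (size Us * (3 * size x + 3) + (size (y ++ passes Us x)).+2)
    (clean (y ++ passes Us x)).
Proof.
elim: Us y T => [|U Us IH] y T pT /=; first by rewrite cats0; apply: reset_exits pT.
rewrite mulSn -addnA; apply: seqm_exits (pass_exits U pT) _ => T' /IH.
by rewrite -catA.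
Qed.

Lemma passes_clean_linear Us : clean_linear (passes Us).
Proof.
(* Copying costs [2 * size x + 3], each pass [3 * size x + 3], and the final rewind two more than
   the output length, to which each pass contributes at most [2 * size x]. *)
exists (seqm copy_machine (passes_machine Us)), (5 * size Us + 5) => x.
have sz := size_passes Us x; split=> [|T cT]; first by nia.
apply: exitsW (seqm_exits (copy_exits cT) (@passes_exits Us _ _)) => //=.
by nia.
Qed.

(** * Translation into Turing machines *)

Definition safe_move (a : action) (c : cell) : move :=
  if (c, a.2) is (None, MoveL) then MoveS else a.2.

Definition tm_of_delta (M : machine) (q : option (mstate M)) (r : {ffun 'I_2 -> cell}) :
    option (mstate M) * {ffun 'I_2 -> cell} * {ffun 'I_2 -> move} :=
  if q is Some q0 then
    let '(q', a1, a2) := mdelta q0 (r ord0) (r ord_max) in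
    let a (i : 'I_2) := if val i == 0 then a1 else a2 in
    (q', [ffun i => omap (fun=> (a i).1) (r i)], [ffun i => safe_move (a i) (r i)])
  else (None, r, [ffun=> MoveS]).

Definition tm_of (M : machine) : TM Sigma 2 :=
  {| tm_state := option (mstate M);
     tm_gamma := cell;
     tm_inp := fun s => Some (Some s);
     tm_lend := None;
     tm_blank := Some None;
     tm_start := Some (mstart M);
     tm_halt := fun q => q == None;
     tm_accept := fun q => q == None;
     tm_delta := @tm_of_delta M |}.

Lemma tm_of_wf M : TM_wf (tm_of M).
Proof.
split=> //=; first by move=> x y [].
move=> [q|] // r _ i; rewrite /tm_of_delta.
case: (mdelta _ _ _) => [[q' a1] a2]; rewrite !ffunE /safe_move.
by case: (r i) => //=; split=> //; case: (_ == 0); [case: a1.2 | case: a2.2].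
Qed.

Definition simulates (M : machine) (c : config (tm_of M)) (c' : mconfig M) : Prop :=
  [/\ cf_state c = c'.1, cf_tape c ord0 =1 c'.2.1.1, cf_head c ord0 = c'.2.1.2,
      cf_tape c ord_max =1 c'.2.2.1 & cf_head c ord_max = c'.2.2.2].

Lemma simulates_step M (c : config (tm_of M)) (c' : mconfig M) :
  simulates c c' -> simulates (step c) (mstep c').
Proof.
case: c => q t h; case: c' => [q' [[f1 h1] [f2 h2]]] [/= -> e1 <- e2 <-].
case: q' => [q'|] //=; rewrite /step /mstep /= !ffunE e1 e2 /read /=.
case: (mdelta _ _ _) => [[q'' a1] a2].
split=> //=; rewrite ?ffunE /=.
- by move=> n; rewrite /act_tape /read /= !e1 ?ffunE.
- by rewrite /act_head /read /= e1 /safe_move; case: (f1 _) => //; case: a1.2.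
- by move=> n; rewrite /act_tape /read /= !e2 ?ffunE.
- by rewrite /act_head /read /= e2 /safe_move; case: (f2 _) => //; case: a2.2.
Qed.

Lemma nth_inp (x : seq Sigma) n :
  nth (Some None) [seq Some (Some s) | s <- x] n = Some (onth x n).
Proof. by elim: x n => [|s x IH] [|n] //=. Qed.

Lemma clean_linear_computable f : clean_linear f -> linear_time_computable 2 f.
Proof.
(* The successor makes the constant positive. *)
move=> [M [C HM]]; exists (tm_of M), C.+1; split; first exact: tm_of_wf.
split=> // x; have [_ Hx] := HM x.
have [|t le [q0 [e1 _ _ _]]] := Hx ((tape_of x, 0), (tape_of [::], 0)); first by [].
exists t; first by nia.
have: simulates (init_config (tm_of M) x)
        (Some (mstart M), ((tape_of x, 0), (tape_of [::], 0))).
  by split=> //= -[|n] //=; rewrite ?nth_inp ?onth0n.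
have H n (c : config (tm_of M)) c' :
    simulates c c' -> simulates (iter n (@step _ _ _) c) (iter n (@mstep M) c').
  by move=> scc; elim: n => //= n; apply: simulates_step.
move=> /(H t)[es et _ _ _]; split; rewrite ?es ?q0 // => _ i0 i00.
have -> : i0 = ord0 by apply: val_inj.
split; rewrite ?et ?e1 //=; last by rewrite onth_default.
by move=> j _; rewrite et e1 /= nth_inp.
Qed.

End Machines.

(** * Free group, lamps and sorted word lists *)

Lemma linvK : involutive linv.
Proof. by case=> a b; rewrite /linv /= negbK. Qed.

Lemma cons_redE x w :
  cons_red x w = if ohead w == Some (linv x) then behead w else x :: w.
Proof. by case: w. Qed.

Lemma cons_redK x w : reduced w -> cons_red x (cons_red (linv x) w) = w.
Proof.
case: w => [|y w] /=; first by rewrite eqxx.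
rewrite linvK; case: eqP => [->|_] /=; last by rewrite eqxx.
(* The letter [x] was cancelled and has to be restored; by reducedness the rest does not begin with
   [linv x]. *)
by case: w => [|z w] //= /andP[/negPf-> _].
Qed.

(** If [x] cancels the first letter of [u], then [cons_redK] cancels the same pair in its action on
    [v]. Associativity follows by induction on the left factor. *)
Lemma foldr_cons_red_cons x u v : reduced v ->
  foldr cons_red v (cons_red x u) = cons_red x (foldr cons_red v u).
Proof.
case: u => [|y u] //= rv; case: eqP => //= ->.
by rewrite cons_redK //; apply: foldr_cons_red_reduced.
Qed.

Lemma F2mulA u v w : F2mul u (F2mul v w) = F2mul (F2mul u v) w.
Proof.
apply: val_inj; case: u v w => [u ru] [v rv] [w rw] /= {ru}.
by elim: u => //= x u ->; rewrite foldr_cons_red_cons.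
Qed.

Lemma F2mul1 u : F2mul F2one u = u.
Proof. exact: val_inj. Qed.

Definition gen (x : letter) : F2 := exist _ [:: x] isT.

Definition word_prod (u : seq letter) : F2 := foldr (fun x => F2mul (gen x)) F2one u.

Lemma word_prodE (u : F2) : word_prod (sval u) = u.
Proof.
apply: val_inj; case: u => /=; elim=> //= x u IH rxu.
rewrite IH; last exact: path_sorted rxu.
by case: u rxu {IH} => //= y u /andP[/negPf->].
Qed.

Lemma F2mulr1 u : F2mul u F2one = u.
Proof.
rewrite -(word_prodE u); elim: (sval u) => [|x w IH] /=; first exact: F2mul1.
by rewrite -F2mulA IH.
Qed.

(** As a product in the group, the inverse is reduced by construction. *)
Fixpoint inv_prod (u : seq letter) : F2 :=
  if u is x :: u' then F2mul (inv_prod u') (gen (linv x)) else F2one.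
Definition F2inv (u : F2) : F2 := inv_prod (sval u).

Lemma gen_linvl x : F2mul (gen (linv x)) (gen x) = F2one.
Proof. by apply: val_inj; rewrite /= linvK eqxx. Qed.

Lemma gen_linvr x : F2mul (gen x) (gen (linv x)) = F2one.
Proof. by apply: val_inj; rewrite /= eqxx. Qed.

Lemma F2mulV u : F2mul (F2inv u) u = F2one.
Proof.
rewrite -{2}(word_prodE u) /F2inv; elim: (sval u) => [|x w IH] /=; first exact: F2mul1.
by rewrite -F2mulA [X in F2mul _ X]F2mulA gen_linvl F2mul1.
Qed.

Lemma F2mulrV u : F2mul u (F2inv u) = F2one.
Proof.
rewrite -{1}(word_prodE u) /F2inv; elim: (sval u) => [|x w IH] /=; first exact: F2mul1.
by rewrite -F2mulA [X in F2mul _ X]F2mulA IH F2mul1 gen_linvr.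
Qed.

Lemma F2mulK u v : F2mul (F2inv u) (F2mul u v) = v.
Proof. by rewrite F2mulA F2mulV F2mul1. Qed.

Lemma F2mulVK u v : F2mul u (F2mul (F2inv u) v) = v.
Proof. by rewrite F2mulA F2mulrV F2mul1. Qed.

Lemma F2inv_unique u v : F2mul u v = F2one -> u = F2inv v.
Proof. by move=> e; rewrite -[u]F2mulr1 -(F2mulrV v) F2mulA e F2mul1. Qed.

Lemma F2invM u v : F2inv (F2mul u v) = F2mul (F2inv v) (F2inv u).
Proof. by apply/esym/F2inv_unique; rewrite -F2mulA F2mulK F2mulV. Qed.

Lemma F2invK : involutive F2inv.
Proof. by move=> u; apply/esym/F2inv_unique; rewrite F2mulrV. Qed.

(** * Lamp configurations under translation *)

Lemma in_symdiff (A B : {fset F2}) x :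
  (x \in symdiff A B) = (x \in A) (+) (x \in B).
Proof. by rewrite !inE; case: (x \in A); case: (x \in B). Qed.

Lemma in_translate g (A : {fset F2}) x :
  (x \in translate g A) = (F2mul (F2inv g) x \in A).
Proof.
apply/imfsetP/idP => [[y yA ->]|xA]; first by rewrite F2mulK.
by exists (F2mul (F2inv g) x); rewrite ?F2mulVK.
Qed.

Lemma translateM g h A : translate (F2mul g h) A = translate g (translate h A).
Proof. by apply/fsetP => x; rewrite !in_translate F2invM F2mulA. Qed.

Lemma translate1 A : translate F2one A = A.
Proof. by apply/fsetP => x; rewrite in_translate /F2inv F2mul1. Qed.

Lemma translate_symdiff g A B :
  translate g (symdiff A B) = symdiff (translate g A) (translate g B).
Proof. by apply/fsetP => x; rewrite in_translate !in_symdiff !in_translate. Qed.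

Lemma symdiffA A B C : symdiff A (symdiff B C) = symdiff (symdiff A B) C.
Proof. by apply/fsetP => x; rewrite !in_symdiff addbA. Qed.

(** * The lexicographic order and sorted word lists *)

Definition lcode (x : letter) : nat := x.1.*2 + x.2.

Lemma lcode_inj : injective lcode.
Proof. by case=> [[] []] [[] []]. Qed.

Fixpoint wlt (u v : seq letter) : bool :=
  match u, v with
  | _, [::] => false
  | [::], _ :: _ => true
  | x :: u', y :: v' => (lcode x < lcode y) || (x == y) && wlt u' v'
  end.

Lemma wlt_irr : irreflexive wlt.
Proof. by elim=> //= x u ->; rewrite ltnn andbF. Qed.

Lemma wlt_trans : transitive wlt.
Proof.
move=> v u; elim: u v => [|x u IH] [|y v] [|z w] //=.
case/orP=> [lt1|/andP[/eqP-> uv]] /orP[lt2|/andP[/eqP<- vw]].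
- by rewrite (ltn_trans lt1 lt2).
- by rewrite lt1.
- by rewrite lt2.
- by rewrite eqxx (IH v w) ?orbT.
Qed.

Lemma wlt_total u v : [|| u == v, wlt u v | wlt v u].
Proof.
elim: u v => [|x u IH] [|y v] //=; rewrite eqseq_cons [y == x]eq_sym.
case: ltngtP => [||/lcode_inj->]; rewrite ?orbT // eqxx.
exact: IH.
Qed.

Definition wle (u v : seq letter) := (u == v) || wlt u v.

Definition words (B : {fset F2}) : seq (seq letter) :=
  sort wle [seq sval b | b <- enum_fset B].

Lemma mem_words (B : {fset F2}) (b : F2) : (sval b \in words B) = (b \in B).
Proof. by rewrite mem_sort (mem_map val_inj). Qed.

Lemma words_sorted (B : {fset F2}) : sorted wlt (words B).
Proof.
have wle_trans : transitive wle.
  move=> v u w; rewrite /wle => /orP[/eqP->//|uv] /orP[/eqP<-|vw].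
    by rewrite uv orbT.
  by rewrite (wlt_trans uv vw) orbT.
(* Sorting gives the weak order; the absence of duplicates makes it strict. *)
have: uniq (words B) by rewrite sort_uniq (map_inj_uniq val_inj) fset_uniq.
have: sorted wle (words B).
  by apply: sort_sorted => u v; rewrite /wle; case/or3P: (wlt_total u v) => ->; rewrite ?orbT.
rewrite !sorted_pairwise //; last exact: wlt_trans.
elim: (words B) => //= w l IH /andP[/allP lew ple] /andP[wl ul].
rewrite IH // andbT; apply/allP => v vl; have := lew v vl.
by rewrite /wle; case: eqP => // e; rewrite e vl in wl.
Qed.

Lemma words_reduced (B : {fset F2}) w : w \in words B -> reduced w.
Proof. by rewrite mem_sort => /mapP[b _ ->]; apply: (svalP b). Qed.

(** A strictly sorted list is determined by its members. This turns identities about [words] into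
    checks of order and membership. *)
Lemma words_eq (B : {fset F2}) l : sorted wlt l ->
  (forall w, w \in l -> reduced w) ->
  (forall b : F2, (sval b \in l) = (b \in B)) -> l = words B.
Proof.
move=> sl rl el; apply: (irr_sorted_eq wlt_trans wlt_irr) => // [|w].
  exact: words_sorted.
have [rw|nrw] := boolP (reduced w); first by rewrite (el (exist _ w rw)) -mem_words.
by apply/idP/idP => [/rl|/words_reduced] rw; rewrite rw in nrw.
Qed.

(** * Left multiplication and toggling on sorted lists *)

Definition cancels (x : letter) (w : seq letter) : bool := ohead w == Some (linv x).

(** [None] stands for the empty word, which precedes the whole block of words beginning with [x]. *)
Definition before (x : letter) (o : option letter) : bool :=
  if o is Some z then lcode z < lcode x else true.

(* Words of a sorted list that cancel the letter [x] lose their first letter;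
   the others get [x] in front and end up in the block of words that begin
   with [x], which sits between the two halves of the former. *)
Definition lmul_words (x : letter) (l : seq (seq letter)) : seq (seq letter) :=
  [seq behead w | w <- l & cancels x w && before x (ohead (behead w))] ++
  [seq x :: w | w <- l & ~~ cancels x w] ++
  [seq behead w | w <- l & cancels x w && ~~ before x (ohead (behead w))].

Lemma mem_lmul_words x l v :
  (v \in lmul_words x l) = (v \in [seq cons_red x w | w <- l]).
Proof.
rewrite !mem_cat; apply/or3P/mapP.
  case=> /mapP[w]; rewrite mem_filter => /andP[/= c wl] ->; exists w => //;
    rewrite cons_redE -/(cancels x w).
  - by case/andP: c => ->.
  - by rewrite (negPf c).
  - by case/andP: c => ->.
case=> w wl ->; rewrite cons_redE -/(cancels x w); case: ifPn => c.
  case b: (before x (ohead (behead w))).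
    by apply: Or31; apply: map_f; rewrite mem_filter c b.
  by apply: Or33; apply: map_f; rewrite mem_filter c b.
by apply: Or32; apply: map_f; rewrite mem_filter c.
Qed.

Lemma wlt_behead x u v : cancels x u -> cancels x v ->
  wlt u v -> wlt (behead u) (behead v).
Proof.
by case: u v => [|y u] [|z v] //= /eqP[->] /eqP[->]; rewrite ltnn eqxx.
Qed.

(** Removing the common letter [linv x], or adding the common letter [x], preserves the order within
    a block; different blocks are separated by comparing first letters with [x]. *)
Lemma lmul_words_sorted x l : (forall w, w \in l -> reduced w) ->
  sorted wlt l -> sorted wlt (lmul_words x l).
Proof.
move=> rl; rewrite !(sorted_pairwise wlt_trans) => pl.
have strip p : pairwise wlt [seq behead w | w <- l & cancels x w && p w].
  rewrite pairwise_map; apply: (@sub_in_pairwise _ (cancels x) wlt).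
  - by move=> u v cu cv; apply: (@wlt_behead x).
  - by apply/allP => w; rewrite mem_filter => /andP[/andP[]].
  - exact: pairwise_filter.
(* Reducedness enters here: [linv x] is not followed by [x], so a stripped word that is not before
   the block begins with a strictly larger letter. *)
have far w : w \in l -> cancels x w -> ~~ before x (ohead (behead w)) ->
    exists z w', behead w = z :: w' /\ lcode x < lcode z.
  move=> /rl; case: w => [|y [|z w]] //= + /eqP[ey]; rewrite /reduced /= ey linvK.
  move=> /andP[zx _]; rewrite -leqNgt => le; exists z, w; split=> //.
  rewrite ltn_neqAle le andbT; apply: contra zx => /eqP/lcode_inj->.
  exact: eqxx.
rewrite !pairwise_cat !strip /= andbT; apply/and3P; split.
- apply/allrelP => u v /mapP[u']; rewrite mem_filter => /andP[/andP[cu bu] ul] ->.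
  rewrite mem_cat => /orP[] /mapP[v']; rewrite mem_filter.
    move=> _ ->; move: bu; case: (behead u') => //= z w -> //.
  case/andP=> /andP[cv nbv] vl ->; have [z [w [-> ltz]]] := far v' vl cv nbv.
  by move: bu; case: (behead u') => //= y w' lty; rewrite (ltn_trans lty).
- apply/allrelP => u v /mapP[u' _ ->] /mapP[v']; rewrite mem_filter.
  case/andP=> /andP[cv nbv] vl ->; have [z [w [-> ltz]]] := far v' vl cv nbv.
  by rewrite /= ltz.
- rewrite pairwise_map; apply: sub_pairwise (pairwise_filter _ pl) => u v /= ->.
  by rewrite eqxx orbT.
Qed.

Lemma words_translate x B : words (translate (gen x) B) = lmul_words x (words B).
Proof.
apply/esym/words_eq.
- by apply: lmul_words_sorted (words_sorted B); apply: words_reduced.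
- move=> w; rewrite mem_lmul_words => /mapP[v /words_reduced rv ->].
  exact: cons_red_reduced.
move=> b; rewrite mem_lmul_words in_translate -mem_words.
apply/mapP/idP => [[w wB eb]|bB].
  have rw := words_reduced wB.
  have -> : b = F2mul (gen x) (exist _ w rw) by apply: val_inj.
  by rewrite F2mulK.
exists (sval (F2mul (F2inv (gen x)) b)) => //.
by rewrite -[b in LHS](F2mulVK (gen x)).
Qed.

(** The empty word is the least one, so in a sorted list it can only be the head. *)
Definition toggle_words (l : seq (seq letter)) : seq (seq letter) :=
  if l is [::] :: l' then l' else [::] :: l.

Lemma words_toggle B :
  words (symdiff B [fset F2one]%fset) = toggle_words (words B).
Proof.
have sB := words_sorted B.
have nil_in : ([::] \in words B) = (ohead (words B) == Some [::]).
  case: (words B) sB => //= w l; rewrite (path_sortedE wlt_trans) => /andP[/allP aw _].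
  by rewrite inE; case: w aw => //= y w aw; apply/negP => /aw.
apply/esym/words_eq.
- case: (words B) sB => [|[|y w] l] //=; exact: path_sorted.
- have := @words_reduced B; case: (words B) => [|[|y w] l] //= rl v.
  + by rewrite inE => /eqP->.
  + by move=> vl; apply: rl; rewrite inE vl orbT.
  + by rewrite inE => /orP[/eqP->//|]; apply: rl.
move=> b; rewrite in_symdiff -mem_words inE -(inj_eq val_inj) /=.
have [->|/negPf nb] := eqVneq (sval b) [::].
  rewrite nil_in; case: (words B) sB => [|[|y w] l] //=.
  rewrite (path_sortedE wlt_trans) => /andP[/allP aw _].
  by apply/negP => /aw.
rewrite addbF; case: (words B) => [|[|y w] l] /=; rewrite ?inE nb //.
Qed.

(** * Transducers on encoded elements *)

Local Notation sym := (option (option letter)).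

(* [Some None] terminates a word, and [None] separates the lamps from the
   position. *)
Definition enc_word (w : seq letter) : seq sym :=
  [seq Some (Some y) | y <- w] ++ [:: Some None].
Definition enc_words (l : seq (seq letter)) : seq sym := flatten (map enc_word l).
Definition enc (X : WP) : seq sym :=
  enc_words (words X.1) ++ None :: enc_word (sval X.2).

(** Serves to prove [enc] injective. Separators are ignored, since the position is always the last
    word; the default of [head] matters only for malformed codes. *)
Fixpoint dec (s : seq sym) : seq (seq letter) :=
  match s with
  | [::] => [::]
  | None :: s' => dec s'
  | Some None :: s' => [::] :: dec s'
  | Some (Some y) :: s' => (y :: head [::] (dec s')) :: behead (dec s')
  end.

Lemma dec_word w s : dec (enc_word w ++ s) = w :: dec s.
Proof. by elim: w => //= y w ->. Qed.

Lemma dec_enc X : dec (enc X) = rcons (words X.1) (sval X.2).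
Proof.
rewrite /enc /enc_words; elim: (words X.1) => [|w l IH] /=.
  by rewrite -[enc_word _]cats0 dec_word.
by rewrite -catA dec_word IH.
Qed.

Lemma enc_inj : injective enc.
Proof.
move=> [B k] [B' k'] /(congr1 dec); rewrite !dec_enc => /rcons_inj[eB ek].
congr pair; last exact: val_inj.
by apply/fsetP => b; rewrite -!mem_words eB.
Qed.

(** [Start] is the beginning of a word and [Second] the place after a cancelled first letter; [Copy]
    and [Drop] handle the rest, and [Skip] passes over one side of the separator. *)
Inductive mode := Start | Second | Copy | Drop | Skip.

Definition mode_code (m : mode) : 'I_5 :=
  inord (match m with Start => 0 | Second => 1 | Copy => 2 | Drop => 3 | Skip => 4 end).
Definition mode_decode (i : 'I_5) : mode :=
  match val i with 0 => Start | 1 => Second | 2 => Copy | 3 => Drop | _ => Skip end.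
Lemma mode_codeK : cancel mode_code mode_decode.
Proof. by case; rewrite /mode_code /mode_decode /= inordK. Qed.
HB.instance Definition _ := Finite.copy mode (can_type mode_codeK).

Local Notation reply := (mode * option sym * option sym)%type.

Definition drop_reply (o : option letter) : reply :=
  (if o then Drop else Start, None, None).
Definition copy_reply (o : option letter) : reply :=
  (if o then Copy else Start, Some (Some o), None).

(* [first] and [second] answer to the first and second symbol of a word. *)
Definition word_delta (first second : option letter -> reply) (q : mode) (c : sym) :
    reply :=
  match q, c with
  | Skip, _ | _, None => (Skip, None, None)
  | Start, Some o => first o
  | Second, Some o => second o
  | Copy, Some o => copy_reply o
  | Drop, Some o => drop_reply o
  end.

Definition word_pass first second : transducer sym :=
  Transducer Start (word_delta first second).

Definition strip_first (x : letter) (o : option letter) : reply :=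
  if o == Some (linv x) then (Second, None, None) else drop_reply o.
(** The second symbol of a cancelling word shows the first letter of the stripped word, so [p] is
    decided before anything is output. *)
Definition strip_pass (x : letter) (p : pred (option letter)) : transducer sym :=
  word_pass (strip_first x) (fun o => if p o then copy_reply o else drop_reply o).

Definition prepend_first (x : letter) (o : option letter) : reply :=
  if o == Some (linv x) then drop_reply o
  else (if o then Copy else Start, Some (Some (Some x)), Some (Some o)).
Definition prepend_pass (x : letter) : transducer sym :=
  word_pass (prepend_first x) drop_reply.

Lemma word_pass_copy first second w s :
  @trun _ (word_pass first second) Copy (enc_word w ++ s)
  = enc_word w ++ @trun _ (word_pass first second) Start s.
Proof. by elim: w => //= y w ->. Qed.

Lemma word_pass_drop first second w s :
  @trun _ (word_pass first second) Drop (enc_word w ++ s)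
  = @trun _ (word_pass first second) Start s.
Proof. by elim: w => //= y w ->. Qed.

Lemma word_pass_skip first second s :
  @trun _ (word_pass first second) Skip s = [::].
Proof. by elim: s. Qed.

Lemma word_pass_words first second (p : pred (seq letter)) g l s :
  let U := word_pass first second in
  (forall w t, @trun _ U Start (enc_word w ++ t)
     = (if p w then enc_word (g w) else [::]) ++ @trun _ U Start t) ->
  @trun _ U Start (enc_words l ++ None :: s)
  = enc_words [seq g w | w <- l & p w].
Proof.
move=> U HU; elim: l => [|w l IH] /=; first exact: word_pass_skip.
rewrite /enc_words /= -catA HU IH; by case: (p w).
Qed.

Lemma strip_passE x p l s :
  trun (tstart (strip_pass x p)) (enc_words l ++ None :: s)
  = enc_words [seq behead w | w <- l & cancels x w && p (ohead (behead w))].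
Proof.
apply: word_pass_words => -[|y w] t //=.
rewrite /strip_first /cancels /=; have [/= _|/= _] := eqVneq; last exact: word_pass_drop.
case: w => [|z w] /=; first by case: (p None).
by case: (p (Some z)) => /=; rewrite (word_pass_copy, word_pass_drop).
Qed.

Lemma prepend_passE x l s :
  trun (tstart (prepend_pass x)) (enc_words l ++ None :: s)
  = enc_words [seq x :: w | w <- l & ~~ cancels x w].
Proof.
apply: word_pass_words => -[|y w] t //=.
rewrite /prepend_first /cancels /=; case: eqVneq => /= _; first exact: word_pass_drop.
by rewrite word_pass_copy.
Qed.

Definition position_delta (x : letter) (q : mode) (c : sym) : reply :=
  match q, c with
  | Skip, None => (Start, Some c, None)
  | Skip, _ => (Skip, None, None)
  | Start, _ => if c == Some (Some (linv x)) then (Copy, None, None)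
                else (Copy, Some (Some (Some x)), Some c)
  | _, _ => (Copy, Some c, None)
  end.
Definition position_pass (x : letter) : transducer sym :=
  Transducer Skip (position_delta x).

Lemma position_passE x l k :
  trun (tstart (position_pass x)) (enc_words l ++ None :: enc_word k)
  = None :: enc_word (cons_red x k).
Proof.
have cp s : @trun _ (position_pass x) Copy s = s by elim: s => //= c s ->.
elim: l => [|w l IH] /=.
  congr cons; case: k => [|y k] //=.
  rewrite -[Some (Some y) == _]/(y == linv x).
  by case: eqP => _ /=; rewrite cp.
by rewrite /enc_words /= -catA; elim: w.
Qed.

(** A terminator as very first symbol means that the empty word is present. Without lamps the first
    symbol is the separator, and the empty word is inserted before it. *)
Definition toggle_delta (q : mode) (c : sym) : reply :=
  if q is Start then
    if c == Some None then (Copy, None, None) else (Copy, Some (Some None), Some c)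
  else (Copy, Some c, None).
Definition toggle_pass : transducer sym := Transducer Start toggle_delta.

Lemma toggle_passE l s :
  trun (tstart toggle_pass) (enc_words l ++ None :: s)
  = enc_words (toggle_words l) ++ None :: s.
Proof.
have cp t : @trun _ toggle_pass Copy t = t by elim: t => //= c t ->.
by case: l => [|[|y w] l] /=; rewrite cp.
Qed.

(** * Maps computable on codes *)

Definition implementable (F : WP -> WP) : Prop :=
  exists f, clean_linear f /\ forall X, f (enc X) = enc (F X).

Lemma implementable_comp F G :
  implementable F -> implementable G -> implementable (G \o F).
Proof.
move=> [f [lf ef]] [g [lg eg]]; exists (g \o f); split; first exact: clean_linear_comp.
by move=> X /=; rewrite ef eg.
Qed.

Lemma eq_implementable F G : F =1 G -> implementable F -> implementable G.
Proof. by move=> e [f [lf ef]]; exists f; split=> // X; rewrite -e. Qed.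

Definition lmul (g : F2) (X : WP) : WP := (translate g X.1, F2mul g X.2).
Definition toggle (C : {fset F2}) (X : WP) : WP := (symdiff X.1 C, X.2).

Lemma implementable_toggle1 : implementable (toggle [fset F2one]%fset).
Proof.
exists (passes [:: toggle_pass]); split=> [|X]; first exact: passes_clean_linear.
by rewrite /passes /= cats0 toggle_passE /enc words_toggle.
Qed.

Lemma implementable_gen x : implementable (lmul (gen x)).
Proof.
exists (passes [:: strip_pass x (before x); prepend_pass x;
                   strip_pass x (predC (before x)); position_pass x]).
split=> [|X]; first exact: passes_clean_linear.
rewrite /passes /= !strip_passE prepend_passE position_passE cats0.
rewrite /enc words_translate /enc_words /lmul_words !map_cat !flatten_cat.
by rewrite -!catA.
Qed.

Lemma implementable_lmul g : implementable (lmul g).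
Proof.
rewrite -(word_prodE g); elim: (sval g) => [|x w IH] /=.
  (* The identity map is obtained by toggling the same lamp twice. *)
  apply: eq_implementable (implementable_comp implementable_toggle1 implementable_toggle1).
  move=> [B k]; rewrite /lmul /toggle /= translate1 F2mul1; congr pair.
  by apply/fsetP => b; rewrite !in_symdiff addbK.
apply: eq_implementable (implementable_comp IH (implementable_gen x)).
by move=> [B k]; rewrite /lmul /= translateM F2mulA.
Qed.

(** The lamp at [c] is carried to the identity by [lmul (F2inv c)], toggled there and carried back;
    the lamps of [C] are treated one by one. *)
Lemma implementable_toggle C : implementable (toggle C).
Proof.
have one c : implementable (toggle [fset c]%fset).
  apply: eq_implementable (implementable_comp (implementable_comp
    (implementable_lmul (F2inv c)) implementable_toggle1) (implementable_lmul c)).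
  move=> [B k]; rewrite /lmul /toggle /= F2mulVK; congr pair.
  rewrite translate_symdiff -translateM F2mulrV translate1; congr symdiff.
  apply/fsetP => b; rewrite in_translate !inE.
  by apply/eqP/eqP => [e|->]; rewrite ?F2mulV // -[b](F2mulVK c) e F2mulr1.
elim/finSet_rect: C => C IH.
have [->|[c cC]] := fset_0Vmem C.
  apply: eq_implementable (implementable_lmul F2one) => -[B k].
  rewrite /lmul /toggle /= translate1 F2mul1; congr pair.
  by apply/fsetP => b; rewrite in_symdiff inE addbF.
apply: eq_implementable (implementable_comp (one c) (IH _ (fproperD1 cC))).
move=> [B k]; rewrite /toggle /= -symdiffA; congr (symdiff _ _, _).
apply/fsetP => b; rewrite in_symdiff !inE.
by case: eqP => [->|]; rewrite ?cC.
Qed.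

(** * Right multiplication in the encoded coordinates *)

Definition coords (p : WP) : WP := (translate (F2inv p.2) p.1, F2inv p.2).

Lemma coords_inj : injective coords.
Proof.
move=> [A g] [A' g'] /= [eA /(can_inj F2invK) eg]; subst g'; congr pair.
by rewrite -[A]translate1 -[A']translate1 -(F2mulrV g) !translateM eA.
Qed.

(** With p = (A, g) and s = (C, h), the lamps of the product are A + gC, and (gh)^-1 (A + gC) = h^-1
    (g^-1 A + C), where + is symmetric difference. *)
Lemma coords_mul p s :
  coords (WPmul p s) = lmul (F2inv s.2) (toggle s.1 (coords p)).
Proof.
case: p s => [A g] [C h]; rewrite /coords /lmul /toggle /= F2invM translateM.
by rewrite translate_symdiff -(translateM _ g) F2mulV translate1.
Qed.

(* Z_2 wr F_2 is Cayley 2-tape linear-time computable, with respect to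
   every finite semigroup generating set S (the notion is independent
   of S). *)
Theorem theorem3p5 :
  forall S : seq WP, semigroup_generates WPmul WPone S ->
    cayley_lin_computable 2 WPmul S.
Proof.
move=> S _; pose code p := enc (coords p).
have code_inj : injective code by move=> p q /enc_inj /coords_inj.
(* By choice, [psi] inverts the injective [code]; its values off the language are arbitrary. *)
pose psi u := epsilon (inhabits WPone) (fun p => code p = u).
have psiK p : psi (code p) = p.
  apply: code_inj; rewrite /psi.
  by apply: (epsilon_spec (inhabits WPone) (fun q => code q = code p)); exists p.
exists sym, (fun u => exists p, u = code p), psi; split.
  by move=> _ _ [p ->] [q ->]; rewrite !psiK => ->.
split=> [p|s _]; first by exists (code p); [exists p | exact: psiK].
have [f [lf ef]] := implementable_comp (implementable_toggle s.1)
                      (implementable_lmul (F2inv s.2)).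
exists f; split=> [|_ [p ->]]; first exact: clean_linear_computable.
have -> : f (code p) = code (WPmul p s) by rewrite ef /code coords_mul.
by rewrite !psiK; split=> //; exists (WPmul p s).
Qed.
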